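(* Let $q>2$ be an integer and let $B\subset\{1,\dots,q-1\}$. For any finite non-negative measure $\mu\in \mathrm{M}_{\mathrm{C}_B}(\mathbb{T})$, $$\dim_{\mathrm{H}}(\mu)\ \geq\ 1+\frac{\kappa'(1)}{\log q},$$ where $\kappa$ is the function associated with $q$ and $B$ and $\kappa'(1)$ is its left derivative at $1$.
   Context: $\mathbb{T}=\mathbb{R}/\mathbb{Z}$. For a finite non-negative Borel measure $\mu$ on $\mathbb{T}$, the lower Hausdorff dimension is $$\dim_{\mathrm{H}}(\mu)=\inf\{\alpha:\ \text{there exists a Borel set } F \text{ with } \mu(F)\neq 0 \text{ and } \dim_{\mathrm{H}}F\leq\alpha\},$$ where $\dim_{\mathrm H}F$ is the Hausdorff dimension of the set $F$ (infimum of the empty set is $+\infty$). Fourier coefficients are $\hat\mu(n)=\int_{\mathbb{T}}e^{-2\pi i n x}\,d\mu(x)$. For $A\subset\mathbb{Z}$, $\mathrm{M}_A(\mathbb{T})$ is the set of finite Borel measures $\mu$ on $\mathbb{T}$ with $\hat\mu(n)=0$ for all $n\in\mathbb{Z}\setminus A$. For $B\subset\{1,\dots,q-1\}$, $$\mathrm{C}_B=\{kq^n:\ k\in\mathbb{Z},\ k \bmod q\in B,\ n\geq 0\}\cup\{0\}.$$ Let $\mathbb{R}^q_0=\{(x_0,\dots,x_{q-1})\in\mathbb{R}^q:\ \sum_j x_j=0\}$ and $$W_B=\Bigl\{d\in\mathbb{R}^q_0:\ \sum_{j=0}^{q-1}e^{-\frac{2\pi i mj}{q}}d_j=0\ \text{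 for all } m\in\{0,\dots,q-1\}\setminus B\Bigr\}.$$ The function $\kappa:\mathbb{R}_+\to\mathbb{R}$ is $$\kappa(\theta)=\sup\Bigl\{\theta\log\Bigl(\frac1q\sum_{j=0}^{q-1}|1+v_j|^{\frac1\theta}\Bigr):\ v\in W_B,\ v_j\geq-1\ \text{for all } j\Bigr\}.$$ $\kappa'(1)$ denotes the left derivative of $\kappa$ at $1$; its value is $$\kappa'(1)=\inf\Bigl\{-\frac1q\sum_{j=0}^{q-1}(1+v_j)\log(1+v_j):\ v\in W_B,\ v_j\geq-1\ \text{for all } j\Bigr\}$$ (with $0\log 0=0$). *)

(* Defs.v *)
From HB Require Import structures.
From mathcomp Require Import all_boot all_order all_algebra.
From mathcomp Require Import generic_quotient ring_quotient.
From mathcomp Require Import all_classical all_reals all_analysis.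
From mathcomp Require Import complex.
Set Implicit Arguments.
Unset Strict Implicit.
Unset Printing Implicit Defensive.
Import Order.TTheory GRing.Theory Num.Theory numFieldNormedType.Exports.
Local Open Scope classical_set_scope.
Local Open Scope ring_scope.
Local Open Scope complex_scope.
Local Open Scope quotient_scope.

Section Circle.
Context (R : realType).

(* R / Z : the quotient of the additive group R by [Num.int], with the quotient
   topology. *)
Definition circle : Type :=
  quotient_topology (Quotient.quot
    (GRing.ZmodClosed.clone R (@Num.int_num_subdef R) _)).

HB.instance Definition _ := Topological.on circle.
HB.instance Definition _ := Pointed.on circle.
HB.instance Definition _ := Quotient.on circle.

Definition borel_circle : Type := g_sigma_algebraType (@open circle).

HB.instance Definition _ := Pointed.on borel_circle.
HB.instance Definition _ := Measurable.on borel_circle.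

Definition circle_dist (x y : circle) : R :=
  inf [set `|a - b| | a in [set a : R | \pi_circle a = x]
                    & b in [set b : R | \pi_circle b = y]].

(* [sup set0 = 0], so the empty set has diameter 0; distances on the circle are
   bounded, so every other supremum here is a genuine one. *)
Definition diam (U : set circle) : R :=
  sup [set circle_dist x y | x in U & y in U].

(* The empty set must be singled out because [powR 0 0 = 1]. *)
Definition gauge (s : R) (U : set circle) : R :=
  if U == set0 then 0 else powR (diam U) s.

Definition hausdorff_content (s delta : R) (F : set circle) : \bar R :=
  ereal_inf [set (\sum_(0 <= i <oo) (gauge s (U i))%:E)%E |
    U in [set U : nat -> set circle |
           F `<=` \bigcup_i U i /\ forall i, diam (U i) <= delta]].

Definition hausdorff_measure (s : R) (F : set circle) : \bar R :=
  ereal_sup [set hausdorff_content s delta F | delta in [set d : R | 0 < d]].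

Definition hausdorff_dim (F : set circle) : \bar R :=
  ereal_inf [set s%:E | s in [set s : R | 0 <= s /\ hausdorff_measure s F = 0%E]].

Definition lower_hausdorff_dim
    (mu : {finite_measure set borel_circle -> \bar R}) : \bar R :=
  ereal_inf [set a%:E | a in [set a : R | exists F : set borel_circle,
    [/\ measurable F, mu F <> 0%E & (hausdorff_dim F <= a%:E)%E]]].

(* [expi t] is e^(i t). *)
Definition expi (t : R) : R[i] := cos t +i* sin t.

(* The integrand is 1-periodic, hence independent of the representative. *)
Definition fourier_coef (mu : {finite_measure set borel_circle -> \bar R})
    (n : int) : R[i] :=
  let e (x : borel_circle) := expi (- (2 * pi * n%:~R * repr (x : circle))) in
  Rintegral mu setT (fun x => complex.Re (e x))
    +i* Rintegral mu setT (fun x => complex.Im (e x)).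

(* The non-negative elements of M_A(T). *)
Definition M_spec (A : set int) : set {finite_measure set borel_circle -> \bar R} :=
  [set mu | forall n : int, ~ A n -> fourier_coef mu n = 0].

Definition C_set (q : nat) (B : {set 'I_q}) : set int :=
  [set m : int | m = 0 \/ exists (k : int) (n : nat) (b : 'I_q),
    [/\ b \in B, (k %% q%:Z)%Z = b%:Z & m = k * q%:Z ^+ n]].

Definition W_space (q : nat) (B : {set 'I_q}) : set 'rV[R]_q :=
  [set d | \sum_j d 0 j = 0 /\ forall m : 'I_q, m \notin B ->
    \sum_(j < q) expi (- (2 * pi * (m * j)%N%:R / q%:R)) * (d 0 j)%:C = 0].

(* Meaningful for theta > 0. Then [powR 0 theta^-1 = 0], and the set is nonempty
   (take v = 0) and bounded above. *)
Definition kappa (q : nat) (B : {set 'I_q}) (theta : R) : R :=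
  sup [set theta * ln (q%:R^-1 * \sum_(j < q) powR `|1 + v 0 j| theta^-1) |
        v in [set v : 'rV[R]_q | W_space B v /\ forall j, -1 <= v 0 j]].

(* [lim] is total; [kappa] is convex on the positive reals, so there the limit
   exists. *)
Definition left_derivative (f : R -> R) (x : R) : R :=
  lim ((h^-1 * (f (x + h) - f x)) @[h --> 0^'-]).

End Circle.

(* Main.v *)
(* Averaging [mu] over the translates by the multiples of [q^-n] keeps exactly the
   frequencies divisible by [q^n].  The spectral hypothesis says that the q values
   of level-n averages lying above one level-(n+1) average are, up to this common
   mean, of the form [1 + v] with [v] in [W_B].  So passing from one level to the
   next costs a factor [e^(kappa theta)] in the normalised [l^(1/theta)] norm.
   After N steps the q-adic masses [a_J] at scale [M = q^N], smoothed by a Fejer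
   kernel (a trigonometric polynomial, so that only finitely many Fourier
   coefficients occur), satisfy
     [sum_J a_J^p <= C M^(1-p) e^(N p kappa(1/p))], where [p = 1/theta].
   If [beta < 1 + kappa'(1) / ln q], then for [p > 1] close to 1 the cells of mass
   at least [M^-beta] carry a total mass that decays exponentially in N, and off
   these cells [mu] is dominated by the beta-dimensional Hausdorff measure. *)
Require Import Defs.
From HB Require Import structures.
From mathcomp Require Import all_boot all_order all_algebra.
From mathcomp Require Import ring lra generic_quotient ring_quotient.
From mathcomp Require Import all_classical all_reals all_analysis.
From mathcomp Require Import measurable_realfun complex.
Set Implicit Arguments.
Unset Strict Implicit.
Unset Printing Implicit Defensive.
Import Order.TTheory GRing.Theory Num.Theory numFieldNormedType.Exports.
Local Open Scope classical_set_scope.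
Local Open Scope ring_scope.
Local Notation pi := trigo.pi.

(** * Convexity inequalities for real powers *)

(** Young's inequality for [x] and 1 with the conjugate exponents [s] and [s / (s - 1)]. *)
Lemma bernoulli_powR (R : realType) (x s : R) :
  0 <= x -> 1 <= s -> 1 + s * (x - 1) <= x `^ s.
Proof.
move=> x0; rewrite le_eqVlt => /predU1P[<-|s1].
  by rewrite powRr1// mul1r addrC subrK.
have s0 : 0 < s by lra.
have t0 : 0 < s / (s - 1) by rewrite divr_gt0// subr_gt0.
have st : s^-1 + (s / (s - 1))^-1 = 1 by rewrite invf_div; field; lra.
have := conjugate_powR x0 ler01 s0 t0 st.
rewrite powR1 mulr1 => h.
have -> : 1 + s * (x - 1) = s * (x - 1 / (s / (s - 1))) by field; lra.
rewrite mulrC -ler_pdivlMr//; lra.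
Qed.

(** Apply [bernoulli_powR] to each [y i / m], where [m] is the weighted mean: averaging removes the
    linear term. *)
Lemma jensen_powR (R : realType) (I : finType) (w y : I -> R) (s : R) :
  (forall i, 0 <= w i) -> \sum_i w i = 1 -> (forall i, 0 <= y i) -> 1 <= s ->
  (\sum_i w i * y i) `^ s <= \sum_i w i * y i `^ s.
Proof.
move=> w0 w1 y0 s1; set m := \sum_i _.
have : 0 <= m by apply: sumr_ge0 => i _; apply: mulr_ge0.
rewrite le_eqVlt => /predU1P[<-|m0].
  rewrite powR0 ?gt_eqF//; last by lra.
  by apply: sumr_ge0 => i _; rewrite mulr_ge0// powR_ge0.
have -> : m `^ s = \sum_i w i * (m `^ s * (1 + s * (y i / m - 1))).
  transitivity (m `^ s * ((1 - s) * \sum_i w i + s * (m^-1 * m))).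
    by rewrite w1 mulVf ?gt_eqF//; ring.
  rewrite {2 4}/m !mulr_sumr -big_split mulr_sumr /=.
  by apply: eq_bigr => i _; ring.
apply: ler_sum => i _; rewrite ler_wpM2l//.
have -> : y i `^ s = m `^ s * (y i / m) `^ s.
  rewrite -powRM ?(ltW m0)// ?divr_ge0 ?(ltW m0)//.
  by rewrite mulrC divfK// gt_eqF.
by rewrite ler_wpM2l ?powR_ge0// bernoulli_powR// divr_ge0// ltW.
Qed.

(** * The function [kappa] and its left derivative at 1 *)

Section Kappa.
Context (R : realType) (q : nat) (B : {set 'I_q}).
Hypothesis q_gt0 : (0 < q)%N.

Let qR_gt0 : 0 < q%:R :> R. Proof. by rewrite ltr0n. Qed.

Let avg (f : 'I_q -> R) : R := q%:R^-1 * \sum_j f j.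

Lemma avg_powR_ge1 (f : 'I_q -> R) (p : R) : (forall j, 0 <= f j) ->
  avg f = 1 -> 1 <= p -> 1 <= avg (fun j => f j `^ p).
Proof.
move=> f0 f1 p1.
have := @jensen_powR _ _ (fun _ : 'I_q => q%:R^-1) f p _ _ f0 p1.
rewrite -!mulr_sumr -/(avg _) f1 powR1; apply.
  by move=> _; rewrite invr_ge0 ltW.
by rewrite sumr_const card_ord -[_ *+ _]mulr_natr mulVf// gt_eqF.
Qed.

(* With respect to the probability weights [f j / q], this is the monotonicity
   of power means: the exponents are [1/theta - 1]. *)
Lemma log_avg_powR_slope (f : 'I_q -> R) (t1 t2 : R) :
  (forall j, 0 <= f j) -> avg f = 1 -> 0 < t1 -> t1 <= t2 -> t2 < 1 ->
  (1 - t1) * (t2 * ln (avg (fun j => f j `^ t2^-1))) <=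
  (1 - t2) * (t1 * ln (avg (fun j => f j `^ t1^-1))).
Proof.
move=> f0 f1 t10 t12 t21.
have t20 : 0 < t2 by lra.
pose r t : R := t^-1 - 1.
have rE (t : R) : 0 < t -> r t = (1 - t) / t by move=> ?; rewrite /r; field; lra.
have r2 : 0 < r t2 by rewrite rE// divr_gt0//; lra.
have r1 : 0 < r t1 by rewrite rE// divr_gt0//; lra.
pose w j := q%:R^-1 * f j.
have w0 j : 0 <= w j by rewrite mulr_ge0// invr_ge0 ltW.
have w1 : \sum_j w j = 1 by rewrite -mulr_sumr.
have X t : 0 < t -> 0 < r t ->
    avg (fun j => f j `^ t^-1) = \sum_j w j * f j `^ r t.
  move=> t0 rt; rewrite /avg mulr_sumr; apply: eq_bigr => j _.
  rewrite -mulrA; congr (_ * _).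
  have -> : t^-1 = 1 + r t by rewrite /r; ring.
  rewrite powRD ?powRr1//; apply/implyP => /eqP; lra.
have X2 : 1 <= avg (fun j => f j `^ t2^-1).
  by apply: avg_powR_ge1 => //; rewrite invf_ge1// ltW.
have X1 : 1 <= avg (fun j => f j `^ t1^-1).
  by apply: avg_powR_ge1 => //; rewrite invf_ge1//; lra.
have : (avg (fun j => f j `^ t2^-1)) `^ (r t1 / r t2) <=
    avg (fun j => f j `^ t1^-1).
  rewrite (X t2)// (X t1)//.
  have r12 : 1 <= r t1 / r t2.
    by rewrite ler_pdivlMr// mul1r lerD2r lef_pV2// posrE.
  apply: le_trans (@jensen_powR _ _ w (fun j => f j `^ r t2) _ w0 w1 _ r12) _.
    by move=> j; exact: powR_ge0.
  apply: ler_sum => j _; rewrite -powRrM.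
  by rewrite (_ : r t2 * _ = r t1)//; field; rewrite gt_eqF.
rewrite -ler_ln ?posrE; [|apply: powR_gt0|]; [|lra|lra].
rewrite ln_powR.
set L2 := ln (avg (fun j => f j `^ t2^-1)).
set L1 := ln (avg (fun j => f j `^ t1^-1)).
rewrite mulrAC ler_pdivrMr// !rE// => h.
have := ler_wpM2r (ltW (mulr_gt0 t10 t20)) h.
rewrite (_ : _ * (t1 * t2) = (1 - t1) * (t2 * L2)); last by field; lra.
by rewrite [leRHS](_ : _ = (1 - t2) * (t1 * L1))//; field; lra.
Qed.

Lemma W_avg (v : 'rV[R]_q) : W_space B v -> avg (fun j => 1 + v 0 j) = 1.
Proof.
case=> v0 _; rewrite /avg big_split/= v0 addr0 sumr_const card_ord.
by rewrite mulVf// gt_eqF.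
Qed.

Let kappa_set (t : R) := [set t * ln (q%:R^-1 * \sum_(j < q) `|1 + v 0 j| `^ t^-1)
  | v in [set v : 'rV[R]_q | W_space B v /\ forall j, -1 <= v 0 j]].

(** Nonnegative entries with mean 1 are at most [q], so the mean of their powers is at most
    [q ^ (1 / t)]. The bound makes the [sup] in [kappa] a genuine supremum. *)
Lemma kappa_has_ubound (t : R) : 0 < t -> t <= 1 -> has_ubound (kappa_set t).
Proof.
move=> t0 t1; exists (ln q%:R) => _ [v [Wv v1] <-].
have f0 j : 0 <= 1 + v 0 j by have := v1 j; lra.
have tV : 1 <= t^-1 by rewrite invf_ge1.
have nE : \sum_(j < q) `|1 + v 0 j| `^ t^-1 = \sum_(j < q) (1 + v 0 j) `^ t^-1.
  by apply: eq_bigr => j _; rewrite ger0_norm.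
rewrite nE mulrC -ler_pdivlMr// [leRHS]mulrC.
have X1 := avg_powR_ge1 f0 (W_avg Wv) tV.
have fq j : 1 + v 0 j <= q%:R.
  have <- : \sum_j (1 + v 0 j) = q%:R.
    have := W_avg Wv; rewrite /avg => h.
    by rewrite -[LHS](mulVKf (lt0r_neq0 qR_gt0)) h mulr1.
  by rewrite (bigD1 j)//= lerDl sumr_ge0.
rewrite -ln_powR ler_ln ?posrE ?powR_gt0//; last exact: lt_le_trans X1.
rewrite ler_pdivrMl// mulr_natl -[leRHS]mulr_natr.
apply: le_trans (_ : \sum_(j < q) q%:R `^ t^-1 <= _).
  by apply: ler_sum => j _; rewrite ge0_ler_powR// ?nnegrE// invr_ge0 ltW.
by rewrite sumr_const card_ord mulr_natr.
Qed.

Let kappa_set0 (t : R) : kappa_set t 0.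
Proof.
exists 0; last first.
  under eq_bigr do rewrite mxE addr0 normr1 powR1.
  by rewrite sumr_const card_ord mulVf ?gt_eqF// ln1 mulr0.
split; last by move=> j; rewrite mxE lerN10.
split; first by rewrite big1// => j _; rewrite mxE.
by move=> m _; rewrite big1// => j _; rewrite mxE mulr0.
Qed.

Lemma kappa_ge0 (t : R) : 0 < t -> t <= 1 -> 0 <= kappa B t.
Proof.
by move=> t0 t1; exact: (ub_le_sup (kappa_has_ubound t0 t1) (kappa_set0 t)).
Qed.

Lemma kappa1 : kappa B 1 = 0 :> R.
Proof.
rewrite /kappa (_ : [set _ | _ in _] = [set 0]) ?sup1//.
apply/seteqP; split=> [_ [v [Wv v1] <-]|_ ->]; last exact: (kappa_set0 1).
rewrite invr1 mul1r (eq_bigr (fun j => 1 + v 0 j)).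
  by rewrite -/(avg _) W_avg// ln1.
by move=> j _; rewrite powRr1// ger0_norm//; have := v1 j; lra.
Qed.

(** Take the supremum over [v] in [log_avg_powR_slope]. As [kappa] vanishes at 1, this is the
    monotonicity of its difference quotients there, and it stands in for convexity. *)
Lemma kappa_slope (t1 t2 : R) : 0 < t1 -> t1 <= t2 -> t2 < 1 ->
  (1 - t1) * kappa B t2 <= (1 - t2) * kappa B t1.
Proof.
move=> t10 t12 t21.
rewrite mulrC -ler_pdivlMr; last by lra.
rewrite {1}/kappa; apply: sup_le_ub; first by exists 0; exact: kappa_set0.
move=> _ [v [Wv v1] <-]; rewrite ler_pdivlMr; last by lra.
have f0 j : 0 <= 1 + v 0 j by have := v1 j; lra.
have nE t : \sum_(j < q) `|1 + v 0 j| `^ t^-1 = \sum_(j < q) (1 + v 0 j) `^ t^-1.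
  by apply: eq_bigr => j _; rewrite ger0_norm.
rewrite mulrC nE; apply: le_trans (log_avg_powR_slope f0 (W_avg Wv) t10 t12 t21) _.
apply: ler_wpM2l; first by lra.
have h : has_ubound (kappa_set t1) by apply: kappa_has_ubound; lra.
apply: (ub_le_sup h).
by exists v => //; rewrite nE.
Qed.

Lemma kappa_left_quotient (g : R) : g < left_derivative (kappa B) 1 ->
  exists2 h : R, -1 < h < 0 & kappa B (1 + h) < h * g.
Proof.
set Q := fun h : R => h^-1 * (kappa B (1 + h) - kappa B 1).
have QE h : Q h = h^-1 * kappa B (1 + h) by rewrite /Q kappa1 subr0.
rewrite /left_derivative -/Q => gl.
(* [lim] is meaningful only once convergence is known: the quotients are nondecreasing in [h] and at
   most 0, since [kappa] is nonnegative to the left of 1. *)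
have cQ : cvg (Q h @[h --> 0^'-]).
  apply: nondecreasing_at_left_is_cvgr.
    near=> x => a b; rewrite !in_itv/= => /andP[xa a0] /andP[xb b0] ab.
    have x1 : -1 < x by near: x; apply: nbhs_left_gt; lra.
    have h : (1 - (1 + a)) * kappa B (1 + b) <= (1 - (1 + b)) * kappa B (1 + a).
      by apply: kappa_slope; clear -x1 xa ab b0; lra.
    rewrite !QE; move: (kappa B (1 + a)) (kappa B (1 + b)) h => ka kb.
    rewrite ler_ndivrMl// mulrCA ler_ndivrMl// => h; lra.
  near=> x; have x1 : -1 < x by near: x; apply: nbhs_left_gt; lra.
  exists 0 => _ [h + <-]; rewrite /= in_itv/= => /andP[xh h0].
  rewrite QE nmulr_rle0 ?invr_lt0//.
  by apply: kappa_ge0; lra.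
near (0 : R)^'- => h; exists h.
  apply/andP; split; first by near: h; apply: nbhs_left_gt; lra.
  by near: h; exact: nbhs_left_lt.
have h0 : h < 0 by near: h; exact: nbhs_left_lt.
rewrite -ltr_ndivlMl//.
have : g < Q h by near: h; exact: (cvgr_gt (lim (Q h @[h --> 0^'-]))).
by rewrite QE.
Unshelve. all: by end_near. Qed.

(** One step of the recursion over levels. Dividing [g] by its mean gives [1 + v] with [v] in
    [W_space B]; homogeneity restores the mean. *)
Lemma kappa_avg_powR (g : 'I_q -> R) (t : R) : 0 < t -> t <= 1 ->
  (forall j, 0 <= g j) ->
  (forall m : 'I_q, m \notin B -> m != 0%N :> nat ->
     \sum_(j < q) expi (- (2 * pi * (m * j)%N%:R / q%:R)) * ((g j)%:C)%C = 0) ->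
  (forall m : 'I_q, m != 0%N :> nat ->
     \sum_(j < q) expi (- (2 * pi * (m * j)%N%:R / q%:R)) = 0 :> R[i]) ->
  avg (fun j => g j `^ t^-1) <= expR (kappa B t / t) * avg g `^ t^-1.
Proof.
move=> t0 t1 g0 gB ex0.
have a0 : 0 <= avg g by rewrite mulr_ge0 ?invr_ge0 ?(ltW qR_gt0)// sumr_ge0.
have [aE|a_neq0] := eqVneq (avg g) 0.
  have gE j : g j = 0.
    have /eqP : \sum_j g j = 0.
      by move/eqP: aE; rewrite mulf_eq0 invr_eq0 gt_eqF//= => /eqP.
    by rewrite psumr_eq0// => /allP/(_ j); rewrite mem_index_enum => /(_ isT)/eqP.
  rewrite {1}/avg big1 ?mulr0 ?mulr_ge0 ?expR_ge0 ?powR_ge0// => j _.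
  by rewrite gE powR0// invr_neq0// gt_eqF.
have {a0 a_neq0}a0 : 0 < avg g by rewrite lt0r a_neq0.
set a := avg g in a0 *.
pose v : 'rV[R]_q := \row_j (g j / a - 1).
have vE j : 1 + v 0 j = g j / a by rewrite mxE addrC subrK.
have Sv : \sum_j v 0 j = 0.
  under eq_bigr do rewrite mxE.
  rewrite big_split/= -mulr_suml sumrN sumr_const card_ord.
  have -> : \sum_j g j = q%:R * a by rewrite /a /avg mulVKf// gt_eqF.
  by rewrite mulfK ?gt_eqF// subrr.
(* At [m = 0] the condition is that [v] has sum zero; at any other [m] outside [B] the constant
   subtracted from [g / a] is invisible by [ex0]. *)
have Wv : W_space B v.
  split=> // m mB; have [m0|m0] := eqVneq (nat_of_ord m) 0%N.
    rewrite (eq_bigr (fun j => (v 0 j)%:C%C)); last first.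
      by move=> j _; rewrite m0 mul0n mulr0 mul0r oppr0 /expi cos0 sin0 mul1r.
    by rewrite -rmorph_sum/= Sv.
  transitivity ((a^-1)%:C%C *
      (\sum_(j < q) expi (- (2 * pi * (m * j)%N%:R / q%:R)) * (g j)%:C%C) -
      \sum_(j < q) expi (- (2 * pi * (m * j)%N%:R / q%:R))).
    rewrite mulr_sumr -sumrB; apply: eq_bigr => j _.
    by rewrite mxE rmorphB rmorphM/= rmorph1; ring.
  by rewrite gB// ex0// mulr0 subr0.
have v1 j : -1 <= v 0 j.
  by have := vE j; have : 0 <= g j / a; [rewrite divr_ge0// ltW|lra].
have gE : avg (fun j => g j `^ t^-1) =
    avg (fun j => `|1 + v 0 j| `^ t^-1) * a `^ t^-1.
  rewrite /avg -mulrA mulr_suml; congr (_ * _); apply: eq_bigr => j _.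
  rewrite vE ger0_norm ?divr_ge0// ?(ltW a0)// -powRM ?divr_ge0 ?(ltW a0)//.
  by rewrite divfK// gt_eqF.
rewrite gE ler_wpM2r ?powR_ge0//.
have f0 j : 0 <= 1 + v 0 j by have := v1 j; lra.
have X1 : 1 <= avg (fun j => `|1 + v 0 j| `^ t^-1).
  rewrite /avg (eq_bigr (fun j => (1 + v 0 j) `^ t^-1)); last first.
    by move=> j _; rewrite ger0_norm.
  by apply: avg_powR_ge1; rewrite ?(W_avg Wv)// invf_ge1.
rewrite -[leLHS]lnK ?posrE; last exact: lt_le_trans X1.
rewrite ler_expR ler_pdivlMr// mulrC.
apply: (ub_le_sup (kappa_has_ubound t0 t1)).
by exists v.
Qed.
End Kappa.

Local Open Scope complex_scope.

(** * Characters of the circle and their orthogonality *)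

Section Exponential.
Context (R : realType).

Definition cexp (t : R) : R[i] := expi (2 * pi * t).

Lemma cexpD (a b : R) : cexp (a + b) = cexp a * cexp b.
Proof.
rewrite /cexp mulrDr /expi cosD sinD; apply/eqP; rewrite eq_complex/=.
by rewrite eqxx/= addrC.
Qed.

Lemma cexp0 : cexp 0 = 1.
Proof. by rewrite /cexp mulr0 /expi cos0 sin0. Qed.

Lemma cexp_nat (n : nat) : cexp n%:R = 1.
Proof.
elim: n => [|n IHn]; first exact: cexp0.
rewrite -natr1 cexpD IHn mul1r /cexp mulr1 /expi mulr_natl.
by rewrite cos2pi sin2pi.
Qed.

Lemma cexp_int (k : int) : cexp k%:~R = 1.
Proof.
case: k => n; first by rewrite -pmulrn cexp_nat.
have := cexpD (Negz n)%:~R n.+1%:R.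
by rewrite NegzE mulrNz -pmulrn addNr cexp0 cexp_nat mulr1.
Qed.

(** Reduce to the fractional part [u]. If [0 < u < 1] then [sin (pi * u)] is positive, whereas
    [cos (2 * pi * u) = 1] forces its square to vanish. *)
Lemma cexp_eq1 (t : R) : cexp t = 1 -> t \is a Num.int.
Proof.
move=> t1; have ft := floor_itv t.
set u := t - (Num.floor t)%:~R.
have u1 : cexp u = 1.
  have := cexpD u (Num.floor t)%:~R.
  by rewrite subrK t1 cexp_int mulr1.
have : 0 <= u < 1 by case/andP: ft; rewrite intrD1 /u => ? ?; lra.
case/andP; rewrite le_eqVlt => /predU1P[u0 _|u0 ult1].
  have -> : t = (Num.floor t)%:~R by apply/eqP; rewrite -subr_eq0 -/u -u0.
  exact: intr_int.
have : cos (2 * pi * u) = 1 by case: u1.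
rewrite -mulrA mulr_natl cos_mulr2n => c1.
have s0 : 0 < sin (pi * u).
  by apply: sin_gt0_pi; rewrite mulr_gt0 ?pi_gt0//= gtr_pMr ?pi_gt0.
have := cos2Dsin2 (pi * u).
have : 0 < sin (pi * u) ^+ 2 by rewrite exprn_gt0.
lra.
Qed.

Lemma cexpM_nat (t : R) (n : nat) : cexp (t * n%:R) = cexp t ^+ n.
Proof.
elim: n => [|n IHn]; first by rewrite mulr0 cexp0.
by rewrite exprSr -IHn -natr1 mulrDr mulr1 cexpD.
Qed.

(** A geometric sum whose ratio [z] is an [n]-th root of unity, equal to 1 exactly when [n] divides
    [k]. *)
Lemma sum_cexp (n : nat) (k : int) : (0 < n)%N ->
  \sum_(j < n) cexp (k%:~R * j%:R / n%:R) = (n%:R * (n%:Z %| k)%Z%:R).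
Proof.
move=> n0; have nR0 : n%:R != 0 :> R by rewrite pnatr_eq0 -lt0n.
under eq_bigr do rewrite mulrAC cexpM_nat.
have [/dvdzP[d ->]|ndvd] := boolP (n%:Z %| k)%Z.
  rewrite intrM -pmulrn mulfK// cexp_int mulr1.
  by under eq_bigr do rewrite expr1n; rewrite sumr_const card_ord.
rewrite mulr0; set z := cexp _.
have : (z - 1) * (\sum_(j < n) z ^+ j) = 0.
  by rewrite -subrX1 -cexpM_nat divfK// cexp_int subrr.
move/eqP; rewrite mulf_eq0 => /orP[|/eqP//].
rewrite subr_eq0 => /eqP/cexp_eq1/intrP[d dE].
case/negP: ndvd; apply/dvdzP; exists d.
apply/eqP; rewrite -(eqr_int R) intrM -dE -pmulrn divfK//.
Qed.

End Exponential.

(** * Averages over [q]-adic translates *)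

Section Averages.
Context (R : realType) (q : nat).

(** Built one base-[q] digit at a time, to match the induction over levels. *)
Fixpoint tower_avg (n : nat) (f : R -> R) (s : R) : R :=
  if n is n'.+1 then
    q%:R^-1 * \sum_(j < q) tower_avg n' f (s + j%:R / (q ^ n)%:R)
  else f s.

Hypothesis q_gt0 : (0 < q)%N.
Let qR_gt0 : 0 < q%:R :> R. Proof. by rewrite ltr0n. Qed.

(** An index below [q ^ n.+1] is [i * q + j]: [i] comes from the inner average and [j] from the new
    digit. *)
Lemma tower_avgE (n : nat) (f : R -> R) (s : R) :
  tower_avg n f s =
  (q ^ n)%:R^-1 * \sum_(i < q ^ n) f (s + i%:R / (q ^ n)%:R).
Proof.
elim: n s => [|n IHn] s.
  by rewrite expn0 big_ord1 invr1 mul1r mul0r addr0.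
rewrite /=; under eq_bigr do rewrite IHn.
rewrite -mulr_sumr mulrA -invfM -natrM -expnS; congr (_ * _).
rewrite exchange_big/= expnSr.
rewrite -(big_mkord xpredT (fun i => f (s + i%:R / (q ^ n * q)%:R))) big_nat_mul.
rewrite big_mkord; apply: eq_bigr => i _.
rewrite -{1}[(i * q)%N]add0n big_addn mulSn addnK big_mkord.
apply: eq_bigr => j _; congr (f _); rewrite -addrA; congr (_ + _).
rewrite natrD !natrM mulrDl; congr (_ + _).
by rewrite invfM mulrACA divff ?mulr1// gt_eqF.
Qed.

Lemma tower_avg_ge0 (n : nat) (f : R -> R) (s : R) :
  (forall x, 0 <= f x) -> 0 <= tower_avg n f s.
Proof.
move=> f0; rewrite tower_avgE mulr_ge0 ?invr_ge0// sumr_ge0//.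
Qed.

End Averages.

(** * Spectral gaps and the recursion between levels *)

Section Spectrum.
Context (R : realType) (q : nat) (B : {set 'I_q}).
Hypotheses (q_gt0 : (0 < q)%N) (B_gt0 : forall b : 'I_q, b \in B -> (0 < b)%N).

(** Elements of [B] are nonzero residues, so a nonzero member of [C_set B] has only one form
    [k * q ^ n] with [q] not dividing [k], and the residue of that [k] is the digit in [B]. *)
Lemma C_set_digit (k : int) (n : nat) (m : 'I_q) :
  C_set B (k * q%:Z ^+ n) -> m != 0%N :> nat -> (q%:Z %| k - m%:Z)%Z -> m \in B.
Proof.
move=> Ck m0 /dvdzP[d kE].
have q0 : q%:Z != 0 by rewrite -lt0n.
have kq : (k %% q)%Z = m.
  by rewrite -(subrK m%:Z k) kE modzMDl modz_small//= ltz_nat ltn_ord.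
have nk : ~ (q%:Z %| k)%Z.
  by move=> /dvdz_mod0P; rewrite kq => -[] /eqP; rewrite (negbTE m0).
case: Ck => [/eqP|[k' [n' [b [bB k'b]]]]].
  rewrite mulf_eq0 expf_eq0 (negbTE q0) andbF orbF => /eqP k0.
  by case: nk; rewrite k0 dvdz0.
have nk' : ~ (q%:Z %| k')%Z.
  move=> /dvdz_mod0P; rewrite k'b => -[b0].
  by have := B_gt0 bB; rewrite b0.
have [nn|nn|->] := ltngtP n n'.
- have -> : k' * q%:Z ^+ n' = k' * q%:Z ^+ (n' - n) * q%:Z ^+ n.
    by rewrite -mulrA -exprD subnK// ltnW.
  move/(mulIf (expf_neq0 n q0)) => kk; case: nk.
  by rewrite kk -subnSK// exprS dvdz_mull// dvdz_mulr.
- have -> : k * q%:Z ^+ n = k * q%:Z ^+ (n - n') * q%:Z ^+ n'.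
    by rewrite -mulrA -exprD subnK// ltnW.
  move/(mulIf (expf_neq0 n' q0)) => kk; case: nk'.
  by rewrite -kk -subnSK// exprS dvdz_mull// dvdz_mulr.
- move/(mulIf (expf_neq0 n' q0)) => kk.
  suff -> : m = b by [].
  by apply/val_inj; move: kq; rewrite kk k'b => -[].
Qed.

Context (I : finType) (c : I -> R[i]) (l : I -> int) (G : R -> R).
Hypothesis spec : forall i, ~ C_set B (l i) -> c i = 0.
Hypothesis GE : forall s, (G s)%:C = \sum_i c i * cexp ((l i)%:~R * s).

Let qR_neq0 : q%:R != 0 :> R. Proof. by rewrite pnatr_eq0 -lt0n. Qed.

(** Shifting by [j / q ^ n.+1] multiplies the character of frequency [k * q ^ n] by a [q]-th root of
    unity; summing over [j] retains it only if [q] divides [k]. *)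
Lemma tower_avg_trig (n : nat) (s : R) :
  (tower_avg q n G s)%:C =
  \sum_(i | (q%:Z ^+ n %| l i)%Z) c i * cexp ((l i)%:~R * s).
Proof.
elim: n s => [|n IHn] s.
  by rewrite GE; apply: eq_bigl => i; rewrite expr0 dvd1z.
rewrite [tower_avg _ _ _ _]/= rmorphM rmorph_sum/=.
under eq_bigr do rewrite IHn.
rewrite exchange_big mulr_sumr/= !(big_mkcond (fun i => _ %| _)%Z)/=.
apply: eq_bigr => i _; case: ifPn => [/dvdzP[k kE]|ndvd]; last first.
  rewrite ifN//; apply: contra ndvd; apply: dvdz_trans.
  by rewrite exprSr dvdz_mulr.
have -> : (q%:Z ^+ n.+1 %| l i)%Z = (q%:Z %| k)%Z.
  by rewrite kE exprS dvdz_mul2r// expf_neq0// -lt0n.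
transitivity (c i * cexp ((l i)%:~R * s) * ((q%:R^-1)%:C *
    \sum_(j < q) cexp (k%:~R * j%:R / q%:R))).
  rewrite !mulr_sumr; apply: eq_bigr => j _.
  rewrite mulrDr cexpD [RHS]mulrCA !mulrA; congr (_ * _ * cexp _).
  rewrite kE intrM rmorphXn/= -pmulrn natrX exprS invfM.
  by field; rewrite qR_neq0 expf_neq0.
rewrite sum_cexp// (mulrA (q%:R^-1)%:C).
have -> : (q%:R^-1)%:C * q%:R = 1 :> R[i].
  by rewrite -(rmorph_nat (real_complex R)) -rmorphM/= mulVf.
by case: ifP => _; rewrite ?mulr1// !mulr0.
Qed.

(** Here the spectral hypothesis enters. The discrete Fourier transform in [j] selects the
    frequencies [k * q ^ n] with [k] congruent to [m], and these lie outside [C_set B]. *)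
Lemma tower_avg_digit (n : nat) (s : R) (m : 'I_q) :
  m \notin B -> m != 0%N :> nat ->
  \sum_(j < q) expi (- (2 * pi * (m * j)%N%:R / q%:R)) *
    (tower_avg q n G (s + j%:R / (q ^ n.+1)%:R))%:C = 0.
Proof.
move=> mB m0; under eq_bigr do rewrite tower_avg_trig mulr_sumr.
rewrite exchange_big/= big1// => i /dvdzP[k kE].
have [/spec->|/contrapT] := pselect (~ C_set B (l i)).
  by rewrite big1// => j _; rewrite mul0r mulr0.
rewrite kE => lC.
transitivity (c i * cexp ((l i)%:~R * s) *
    \sum_(j < q) cexp ((k - m%:Z)%:~R * j%:R / q%:R)).
  rewrite mulr_sumr; apply: eq_bigr => j _.
  have -> : expi (- (2 * pi * (m * j)%N%:R / q%:R)) =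
      cexp (- (m%:R * j%:R / q%:R)) :> R[i].
    by rewrite /cexp; congr expi; rewrite natrM; ring.
  rewrite mulrCA -!mulrA; congr (_ * _); rewrite -!cexpD; congr cexp.
  rewrite kE intrM rmorphXn/= intrB -!pmulrn natrX exprS invfM.
  by field; rewrite qR_neq0 expf_neq0.
rewrite sum_cexp//; have [dvd|_] := boolP (q%:Z %| _)%Z; last by rewrite !mulr0.
by move: mB; rewrite (C_set_digit lC m0 dvd).
Qed.

(** The inductive bound is applied at each of the [q] shifts and [kappa_avg_powR] combines them, so
    every level contributes one factor. *)
Lemma tower_avg_powR (n : nat) (s t : R) : (forall x, 0 <= G x) -> 0 < t -> t <= 1 ->
  tower_avg q n (fun x => G x `^ t^-1) s <=
  expR (kappa B t / t) ^+ n * tower_avg q n G s `^ t^-1.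
Proof.
move=> G0 t0 t1; elim: n s => [|n IHn] s; first by rewrite expr0 mul1r.
pose g (j : 'I_q) := tower_avg q n G (s + j%:R / (q ^ n.+1)%:R).
have g0 j : 0 <= g j by exact: tower_avg_ge0.
apply: (@le_trans _ _ (expR (kappa B t / t) ^+ n *
    (q%:R^-1 * \sum_j g j `^ t^-1))).
  rewrite mulrCA ler_wpM2l ?invr_ge0// mulr_sumr; apply: ler_sum => j _.
  exact: IHn.
rewrite exprSr -mulrA ler_wpM2l ?exprn_ge0 ?expR_ge0//.
apply: kappa_avg_powR => // [m mB m0|m m0]; first exact: tower_avg_digit.
have := @sum_cexp R q (- m%:Z) q_gt0.
have -> : (q%:Z %| - m%:Z)%Z = false.
  by rewrite dvdzE abszN !absz_nat gtnNdvd ?lt0n.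
rewrite mulr0 => h; rewrite -[RHS]h; apply: eq_bigr => j _; congr expi.
by rewrite intrN -pmulrn natrM; ring.
Qed.
End Spectrum.

Local Open Scope quotient_scope.

(** * Functions, integrals and distances on the circle *)

Section Circle.
Context (R : realType).

Lemma circle_eqP (a b : R) :
  \pi_(circle R) a = \pi_(circle R) b <-> exists k : int, a = b + k%:~R.
Proof.
pose I := GRing.ZmodClosed.clone R (@Num.int_num_subdef R) _.
have E : \pi_(circle R) a = \pi_(circle R) b <-> a - b \in I.
  rewrite Quotient.idealrBE; split => [h|/eqP h]; [apply/eqP|]; exact: h.
split=> [/E|[k kE]]; last first.
  by apply/E; rewrite kE addrAC subrr add0r; exact: intr_int.
by move=> /intrP[k kE]; exists k; rewrite -kE addrC subrK.
Qed.

(** Evaluation at a chosen representative; for [int_periodic] functions the choice is immaterial. *)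
Definition circle_fun (f : R -> R) (x : borel_circle R) : R :=
  f (repr (x : circle R)).

Definition int_periodic (f : R -> R) := forall x (k : int), f (x + k%:~R) = f x.

Lemma circle_funE (f : R -> R) (a : R) (x : circle R) :
  int_periodic f -> \pi_(circle R) a = x -> circle_fun f x = f a.
Proof.
move=> pf <-; rewrite /circle_fun.
have /circle_eqP[k ->] : \pi_(circle R) (repr (\pi_(circle R) a)) = \pi_(circle R) a.
  exact: reprK.
exact: pf.
Qed.

(** A continuous periodic function descends to a continuous one on the quotient, so preimages of
    open rays are open. *)
Lemma measurable_circle_fun (f : R -> R) : continuous f -> int_periodic f ->
  measurable_fun setT (circle_fun f).
Proof.
move=> cf pf; apply: (measurability _ (RGenOInfty.measurableE R)).
move=> _ [_ [x ->] <-]; rewrite setTI; apply: sub_sigma_algebra.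
have /continuousP : continuous (f \o (repr : circle R -> R)).
  apply: repr_comp_continuous => // a b /eqP/circle_eqP[k ->].
  by rewrite pf.
apply; exact: interval_open.
Qed.

Lemma measurable_circle_fun_ge (f : R -> R) (c : R) :
  continuous f -> int_periodic f -> measurable [set x | c <= circle_fun f x].
Proof.
move=> cf pf.
have -> : [set x | c <= circle_fun f x] =
    setT `&` circle_fun f @^-1` `[c, +oo[%classic.
  by apply/seteqP; split=> x /=; rewrite in_itv/= andbT => -[].
by apply: (measurable_circle_fun cf pf) => //; exact: measurable_itv.
Qed.

Context (mu : {finite_measure set (borel_circle R) -> \bar R}).

Lemma integrable_circle_fun (f : R -> R) (M : R) : continuous f -> int_periodic f ->
  (forall x, `|f x| <= M) -> mu.-integrable setT (EFin \o circle_fun f).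
Proof.
move=> cf pf fM; apply: measurable_bounded_integrable => //.
- by rewrite ltey_eq fin_num_measure.
- exact: measurable_circle_fun.
exists M; split; first exact: num_real.
by move=> y My x _; apply: le_trans (fM _) (ltW My).
Qed.

Lemma Rintegral_sum (I : Type) (s : seq I) (f : I -> borel_circle R -> R) :
  (forall i, mu.-integrable setT (EFin \o f i)) ->
  \int[mu]_x (\sum_(i <- s) f i x) = \sum_(i <- s) \int[mu]_x f i x.
Proof.
move=> intf; elim: s => [|i s IHs].
  under eq_Rintegral do rewrite big_nil.
  by rewrite big_nil Rintegral_cst// mul0r.
under eq_Rintegral do rewrite big_cons.
rewrite big_cons RintegralD ?IHs//.
rewrite (_ : _ \o _ = (fun x => \sum_(j <- s) (f j x)%:E)%E).
  by apply: integrable_sum => // j _; exact: intf.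
by apply/funext => x /=; rewrite sumEFin.
Qed.

Lemma Rintegral_circle_fun_markov (f : R -> R) (M c : R) :
  continuous f -> int_periodic f ->
  (forall x, `|f x| <= M) -> (forall x, 0 <= f x) -> 0 < c ->
  (mu [set x | (c <= circle_fun f x)%R] <= (c^-1 * \int[mu]_x circle_fun f x)%:E)%E.
Proof.
move=> cf pf fM f0 c0.
have intf := integrable_circle_fun cf pf fM.
set A := [set x | _].
have mA : measurable A by exact: measurable_circle_fun_ge.
rewrite EFinM lee_pdivlMl//.
rewrite -integral_cst// /Rintegral fineK; last first.
  exact: integrable_fin_num.
apply: (@le_trans _ _ (\int[mu]_(x in A) (circle_fun f x)%:E)%E).
  apply: ge0_le_integral => //.
  - by move=> x _; rewrite lee_fin ltW.
  - apply/measurable_EFinP.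
    exact: measurable_funS (measurable_circle_fun cf pf).
apply: ge0_subset_integral => //.
- by apply/measurable_EFinP; exact: measurable_circle_fun.
- by move=> x _; rewrite lee_fin f0.
Qed.

Lemma circle_rep01 (x : circle R) :
  exists2 a : R, \pi_(circle R) a = x & 0 <= a < 1.
Proof.
exists (repr x - (Num.floor (repr x))%:~R).
  rewrite -[RHS]reprK; apply/circle_eqP; exists (- Num.floor (repr x)).
  by rewrite intrN.
have := floor_itv (repr x); rewrite intrD1 => /andP[? ?].
by apply/andP; split; lra.
Qed.

(** Both points have representatives in [[0, 1)]. The bound makes the suprema in [diam] genuine. *)
Lemma circle_dist_ub (x y : circle R) : circle_dist x y <= 1.
Proof.
have [a ax a01] := circle_rep01 x; have [b bx b01] := circle_rep01 y.
apply: (@le_trans _ _ `|a - b|).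
  apply: ge_inf; first by exists 0 => _ [? _ [? _ <-]].
  by exists a => //; exists b.
by rewrite ler_norml; lra.
Qed.

Let circle_dist_neq0 (x y : circle R) :
  [set `|a - b| | a in [set a : R | \pi_(circle R) a = x]
                & b in [set b : R | \pi_(circle R) b = y]] !=set0.
Proof.
by exists `|repr x - repr y|; exists (repr x); rewrite /= ?reprK//;
  exists (repr y); rewrite /= ?reprK.
Qed.

(** A strict bound on the infimum in [circle_dist] is witnessed by actual representatives, on which
    the kernel can be estimated. *)
Lemma diam_close (U : set (circle R)) (r : R) (x y : circle R) :
  U x -> U y -> diam U < r ->
  exists a b, [/\ \pi_(circle R) a = x, \pi_(circle R) b = y & `|a - b| < r].
Proof.
move=> Ux Uy Ur.
have : circle_dist x y < r.
  apply: le_lt_trans Ur; apply: ub_le_sup.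
    by exists 1 => _ [? _ [? _ <-]]; exact: circle_dist_ub.
  by exists x => //; exists y.
move=> /(inf_lt (circle_dist_neq0 x y))[].
by move=> _ [a ax [b bx <-]] abr; exists a, b.
Qed.

Lemma diam_ge0 (U : set (circle R)) : 0 <= diam U.
Proof.
have [->|/set0P[x Ux]] := eqVneq U set0.
  rewrite /diam (_ : [set _ | _ in _ & _ in _] = set0) ?sup0//.
  by apply/seteqP; split=> // y [x []].
have : circle_dist x x <= diam U.
  apply: ub_le_sup; first by exists 1 => _ [? _ [? _ <-]]; exact: circle_dist_ub.
  by exists x => //; exists x.
apply: le_trans; apply: lb_le_inf; first exact: circle_dist_neq0.
by move=> _ [? _ [? _ <-]].
Qed.
End Circle.

(** * The Fejer kernel *)

Section Fejer.
Context (R : realType).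

(** The squared modulus of the sum of [e^(2 pi i k x)] over [k < K], divided by [K ^+ 2]. This is
    the usual Fejer kernel over [K], so for [K > 0] its value at 0 is 1. *)
Definition fejer (K : nat) (x : R) : R := (K%:R ^+ 2)^-1 *
  ((\sum_(k < K) cos (2 * pi * (k%:R * x))) ^+ 2 +
   (\sum_(k < K) sin (2 * pi * (k%:R * x))) ^+ 2).

Lemma fejer_ge0 (K : nat) (x : R) : 0 <= fejer K x.
Proof. by rewrite mulr_ge0 ?invr_ge0 ?exprn_ge0// addr_ge0// sqr_ge0. Qed.

(** Indexing frequencies by pairs avoids counting the multiplicity of each difference. *)
Definition freq (K : nat) (p : 'I_K * 'I_K) : int := p.1%:Z - p.2%:Z.

Lemma fejerE (K : nat) (x : R) : fejer K x = (K%:R ^+ 2)^-1 *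
  \sum_(p : 'I_K * 'I_K) cos (2 * pi * ((freq p)%:~R * x)).
Proof.
rewrite /fejer; congr (_ * _); rewrite !expr2 !big_distrlr/= -big_split/=.
under eq_bigr do rewrite -big_split/=.
rewrite pair_big/=; apply: eq_bigr => -[a b] _ /=.
by rewrite -cosB /freq/= intrB -!pmulrn; congr cos; ring.
Qed.

Lemma cos_int_periodic (t : R) (k : int) :
  cos (2 * pi * (t + k%:~R)) = cos (2 * pi * t).
Proof.
have : cexp (t + k%:~R) = cexp t by rewrite cexpD cexp_int mulr1.
by move=> /(congr1 (@complex.Re R)).
Qed.

Lemma sin_int_periodic (t : R) (k : int) :
  sin (2 * pi * (t + k%:~R)) = sin (2 * pi * t).
Proof.
have : cexp (t + k%:~R) = cexp t by rewrite cexpD cexp_int mulr1.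
by move=> /(congr1 (@complex.Im R)).
Qed.

Lemma fejer_periodic (K : nat) (s : R) : int_periodic (fun x => fejer K (x - s)).
Proof.
move=> x k; rewrite !fejerE; congr (_ * _); apply: eq_bigr => p _.
by rewrite addrAC [_ * (_ + k%:~R)]mulrDr -intrM cos_int_periodic.
Qed.

Lemma fejer_bounded (K : nat) (x : R) :
  `|fejer K x| <= (K%:R ^+ 2)^-1 * #|{: 'I_K * 'I_K}|%:R.
Proof.
rewrite fejerE normrM ger0_norm ?invr_ge0 ?exprn_ge0//.
rewrite ler_wpM2l ?invr_ge0 ?exprn_ge0//.
apply: le_trans (ler_norm_sum _ _ _) _.
rewrite -sumr_const ler_sum// => p _.
by rewrite ler_norml cos_le1 cos_geN1.
Qed.

Lemma continuous_sum (I : Type) (r : seq I) (f : I -> R -> R) (x : R) :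
  (forall i, {for x, continuous (f i)}) ->
  {for x, continuous (fun y => \sum_(i <- r) f i y)}.
Proof.
move=> cf; elim: r => [|i r IHr].
  rewrite (_ : (fun _ => _) = cst 0); first exact: cvg_cst.
  by apply/funext => y; rewrite big_nil.
rewrite (_ : (fun _ => _) = (fun y => f i y + \sum_(j <- r) f j y)).
  by apply: cvgD => //; exact: cf.
by apply/funext => y; rewrite big_cons.
Qed.

Lemma fejer_continuous (K : nat) (s : R) : continuous (fun x => fejer K (x - s)).
Proof.
move=> x; apply: cvgM; first exact: cvg_cst.
have lin (k : 'I_K) : {for x, continuous (fun x => 2 * pi * (k%:R * (x - s)))}.
  apply: cvgM; first exact: cvg_cst.
  apply: cvgM; first exact: cvg_cst.
  by apply: cvgB => //; exact: cvg_cst.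
apply: cvgD; apply: cvgM.
all: apply: continuous_sum => k; apply: continuous_comp (lin k) _.
all: by [exact: continuous_cos | exact: continuous_sin].
Qed.

(** [cos (2 * u) >= 0] gives [cos u ^+ 2 >= 1 / 2], and [cos u >= 0] settles the sign. *)
Lemma cos_ge_half (u : R) : `|u| <= pi / 4 -> 2^-1 <= cos u.
Proof.
rewrite ler_norml => /andP[u1 u2]; have pi0 := pi_gt0 R.
have c0 : 0 <= cos u by apply: cos_ge0_pihalf; apply/andP; split; lra.
have c2 : 0 <= cos (u *+ 2).
  by apply: cos_ge0_pihalf; rewrite [u *+ 2]mulr2n; apply/andP; split; lra.
move: c2; rewrite cos_mulr2n [_ ^+ 2 *+ 2]mulr2n => c2.
rewrite leNgt; apply/negP => c1.
have : cos u ^+ 2 < 2^-1 ^+ 2 by rewrite ltr_pXn2r ?nnegrE.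
rewrite !expr2 in c2 *; lra.
Qed.

(** All angles [2 * pi * k * x] are at most [pi / 4] in absolute value, so the cosine sum alone is
    at least [K / 2]. *)
Lemma fejer_ge (K : nat) (x : R) : (0 < K)%N -> K%:R * `|x| <= 8^-1 ->
  4^-1 <= fejer K x.
Proof.
move=> K0 Kx; have KR0 : 0 < K%:R :> R by rewrite ltr0n.
have cosk (k : 'I_K) : 2^-1 <= cos (2 * pi * (k%:R * x)).
  have pi0 := pi_gt0 R.
  set u := 2 * pi * _.
  have u4 : `|u| <= pi / 4.
    rewrite /u !normrM (ger0_norm (ltW pi0)) !normr_nat.
    have : k%:R * `|x| <= 8^-1.
      by apply: le_trans Kx; rewrite ler_wpM2r// ler_nat ltnW.
    move=> /(ler_wpM2l (ltW pi0)); lra.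
  exact: cos_ge_half.
rewrite /fejer ler_pdivlMl ?exprn_gt0//.
apply: (@le_trans _ _ ((\sum_(k < K) cos (2 * pi * (k%:R * x))) ^+ 2)).
  rewrite (_ : _ * _ = (K%:R * 2^-1) ^+ 2); last by field.
  rewrite ler_pXn2r ?nnegrE ?mulr_ge0 ?sumr_ge0//.
    by rewrite mulr_natl -[K in _ *+ K]card_ord -sumr_const ler_sum.
  by move=> k _; apply: le_trans (cosk k).
by rewrite lerDl sqr_ge0.
Qed.
End Fejer.

(** * Fejer means of [mu] *)

Section FejerAvg.
Context (R : realType) (mu : {finite_measure set (borel_circle R) -> \bar R}).

Definition fejer_avg (K : nat) (s : R) : R :=
  \int[mu]_x circle_fun (fun y => fejer K (y - s)) x.

Lemma fejer_avg_ge0 (K : nat) (s : R) : 0 <= fejer_avg K s.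
Proof. by apply: Rintegral_ge0 => x _; exact: fejer_ge0. Qed.

Let cosI (l : int) := \int[mu]_x circle_fun (fun y => cos (2 * pi * (l%:~R * y))) x.
Let sinI (l : int) := \int[mu]_x circle_fun (fun y => sin (2 * pi * (l%:~R * y))) x.

Let cos_int (l : int) :
  mu.-integrable setT (EFin \o circle_fun (fun y => cos (2 * pi * (l%:~R * y)))).
Proof.
apply: (@integrable_circle_fun _ _ _ 1).
- move=> x; apply: continuous_comp; last exact: continuous_cos.
  by apply: cvgM; [exact: cvg_cst|apply: cvgM => //; exact: cvg_cst].
- by move=> x k; rewrite [_ * (_ + k%:~R)]mulrDr -intrM cos_int_periodic.
- by move=> x; rewrite ler_norml cos_le1 cos_geN1.
Qed.

Let sin_int (l : int) :
  mu.-integrable setT (EFin \o circle_fun (fun y => sin (2 * pi * (l%:~R * y)))).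
Proof.
apply: (@integrable_circle_fun _ _ _ 1).
- move=> x; apply: continuous_comp; last exact: continuous_sin.
  by apply: cvgM; [exact: cvg_cst|apply: cvgM => //; exact: cvg_cst].
- by move=> x k; rewrite [_ * (_ + k%:~R)]mulrDr -intrM sin_int_periodic.
- by move=> x; rewrite ler_norml sin_le1 sin_geN1.
Qed.

Let fourier_coefE (l : int) : fourier_coef mu l = Complex (cosI l) (- sinI l).
Proof.
rewrite /fourier_coef; congr Complex.
  by apply: eq_Rintegral => x _ /=; rewrite cosN /circle_fun !mulrA.
rewrite -mulN1r -RintegralZl//; apply: eq_Rintegral => x _ /=.
by rewrite sinN /circle_fun !mulrA mulN1r.
Qed.

Let cosIN (l : int) : cosI (- l) = cosI l.
Proof.
apply: eq_Rintegral => x _; rewrite /circle_fun intrN mulNr mulrN.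
by rewrite cosN.
Qed.

Let sinIN (l : int) : sinI (- l) = - sinI l.
Proof.
rewrite -[RHS]mulN1r -RintegralZl//.
apply: eq_Rintegral => x _; rewrite /circle_fun.
by rewrite intrN mulNr mulrN sinN mulN1r.
Qed.

(** The addition formula for the cosine separates [s] from the variable of integration. *)
Let fejer_avgE (K : nat) (s : R) : fejer_avg K s = (K%:R ^+ 2)^-1 *
  \sum_(p : 'I_K * 'I_K) (cos (2 * pi * ((freq p)%:~R * s)) * cosI (freq p) +
                          sin (2 * pi * ((freq p)%:~R * s)) * sinI (freq p)).
Proof.
have E x : circle_fun (fun y => fejer K (y - s)) x = (K%:R ^+ 2)^-1 *
    \sum_(p : 'I_K * 'I_K)
      (cos (2 * pi * ((freq p)%:~R * s)) *
         circle_fun (fun y => cos (2 * pi * ((freq p)%:~R * y))) x +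
       sin (2 * pi * ((freq p)%:~R * s)) *
         circle_fun (fun y => sin (2 * pi * ((freq p)%:~R * y))) x).
  rewrite /circle_fun fejerE; congr (_ * _); apply: eq_bigr => p _.
  by rewrite mulrBr mulrBr cosB; ring.
have intc (c d : R) l : mu.-integrable setT (EFin \o (fun x =>
    c * circle_fun (fun y => cos (2 * pi * (l%:~R * y))) x +
    d * circle_fun (fun y => sin (2 * pi * (l%:~R * y))) x)).
  exact: (integrableD measurableT (integrableZl measurableT c (cos_int l))
    (integrableZl measurableT d (sin_int l))).
rewrite /fejer_avg; under eq_Rintegral do rewrite E.
rewrite RintegralZl//; last first.
  rewrite (_ : _ \o _ = (fun x => \sum_(p : 'I_K * 'I_K) (
      cos (2 * pi * ((freq p)%:~R * s)) *
         circle_fun (fun y => cos (2 * pi * ((freq p)%:~R * y))) x +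
       sin (2 * pi * ((freq p)%:~R * s)) *
         circle_fun (fun y => sin (2 * pi * ((freq p)%:~R * y))) x)%:E)%E).
    by apply: integrable_sum => // p _; exact: intc.
  by apply/funext => x /=; rewrite sumEFin.
congr (_ * _); rewrite Rintegral_sum//; apply: eq_bigr => p _.
rewrite RintegralD//.
- by rewrite !RintegralZl.
- exact: (integrableZl measurableT _ (cos_int (freq p))).
- exact: (integrableZl measurableT _ (sin_int (freq p))).
Qed.

Lemma sum_Complex (I : finType) (a b : I -> R) :
  \sum_i Complex (a i) (b i) = Complex (\sum_i a i) (\sum_i b i).
Proof. by elim/big_rec3: _ => // i x y z _ ->. Qed.

Definition fejer_avg_coef (K : nat) (p : 'I_K * 'I_K) : R[i] :=
  ((K%:R ^+ 2)^-1)%:C * fourier_coef mu (freq p).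

(** Brings [fejer_avg] into the form required of [G] in the averaging lemmas; the imaginary parts
    cancel. *)
Lemma fejer_avg_trig (K : nat) (s : R) :
  (fejer_avg K s)%:C =
  \sum_(p : 'I_K * 'I_K) fejer_avg_coef p * cexp ((freq p)%:~R * s) :> R[i].
Proof.
under eq_bigr do rewrite /fejer_avg_coef -mulrA.
rewrite -mulr_sumr fejer_avgE rmorphM/=; congr (_ * _).
pose D (p : 'I_K * 'I_K) := cos (2 * pi * ((freq p)%:~R * s)) * - sinI (freq p) +
                          sin (2 * pi * ((freq p)%:~R * s)) * cosI (freq p).
transitivity (\sum_(p : 'I_K * 'I_K) Complex
    (cos (2 * pi * ((freq p)%:~R * s)) * cosI (freq p) +
     sin (2 * pi * ((freq p)%:~R * s)) * sinI (freq p)) (D p)); last first.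
  apply: eq_bigr => p _; rewrite fourier_coefE /cexp /expi/= /D.
  by apply/eqP; rewrite eq_complex/=; apply/andP; split; apply/eqP; ring.
rewrite sum_Complex; apply/eqP; rewrite eq_complex/= eqxx/=.
rewrite eq_sym; set S := \sum_p D p.
(* Exchanging the two indices negates the frequency, and [D] is odd in the frequency. *)
have : S = - S.
  rewrite {1}/S (reindex_inj (h := fun p : 'I_K * 'I_K => (p.2, p.1))); last first.
    by move=> [a b] [c d] [-> ->].
  rewrite /S -sumrN; apply: eq_bigr => -[a b] _; rewrite /D.
  have -> : freq (b, a) = - freq (a, b) by rewrite /freq opprB.
  rewrite (_ : 2 * pi * _ = - (2 * pi * ((freq (a, b))%:~R * s))).
    by rewrite cosN sinN cosIN sinIN; ring.
  by rewrite intrN; ring.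
by move=> S0; apply/eqP; lra.
Qed.

Context (q : nat) (B : {set 'I_q}).
Hypotheses (q_gt0 : (0 < q)%N) (B_gt0 : forall b : 'I_q, b \in B -> (0 < b)%N).
Hypothesis spec : M_spec (C_set B) mu.

Lemma fejer_avg_coef_spec (K : nat) (p : 'I_K * 'I_K) :
  ~ C_set B (freq p) -> fejer_avg_coef p = 0.
Proof. by move=> /spec h; rewrite /fejer_avg_coef h mulr0. Qed.

Lemma fourier_coef0 : fourier_coef mu 0 = (fine (mu setT))%:C.
Proof.
have c0 : cosI 0 = fine (mu setT).
  transitivity (\int[mu]_x (1 : R)); last by rewrite Rintegral_cst// mul1r.
  by apply: eq_Rintegral => x _; rewrite /circle_fun mul0r mulr0 cos0.
have s0 : sinI 0 = 0.
  transitivity (\int[mu]_x (0 : R)); last by rewrite Rintegral_cst// mul0r.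
  by apply: eq_Rintegral => x _; rewrite /circle_fun mul0r mulr0 sin0.
by rewrite fourier_coefE c0 s0 oppr0.
Qed.

(** Only frequencies divisible by [q ^ N] survive. A difference of indices below [K <= q ^ N] is
    such only on the diagonal, whose [K] terms each contribute the total mass over [K ^+ 2]. *)
Lemma tower_avg_fejer_avg (K N : nat) (s : R) : (0 < K <= q ^ N)%N ->
  tower_avg q N (fejer_avg K) s = K%:R^-1 * fine (mu setT).
Proof.
move=> /andP[K0 KN].
have KR : K%:R != 0 :> R by rewrite pnatr_eq0 -lt0n.
apply: (@complexI R); rewrite (tower_avg_trig q_gt0 (@fejer_avg_trig K)).
rewrite (eq_bigl (fun p : 'I_K * 'I_K => p.1 == p.2)); last first.
  move=> [a b]; rewrite /freq/=; apply/idP/eqP => [|->]; last by rewrite subrr dvdz0.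
  wlog ab : a b / (a <= b)%N => [hw|].
    have [/hw//|/ltnW/hw h] := leqP a b.
    by rewrite -opprB dvdzE abszN -dvdzE => /h.
  rewrite -opprB dvdzE abszN subzn// abszX !absz_nat => /dvdn_leq.
  move=> h; apply/val_inj/eqP; rewrite eqn_leq ab/= leqNgt; apply/negP => ba.
  have := h; rewrite subn_gt0 => /(_ ba); rewrite leqNgt => /negP; apply.
  by apply: leq_ltn_trans (leq_subr _ _) (leq_trans (ltn_ord b) KN).
rewrite -(pair_big_dep xpredT (fun a b : 'I_K => a == b)
  (fun a b => fejer_avg_coef (a, b) * cexp ((freq (a, b))%:~R * s)))/=.
transitivity (\sum_(a < K) (((K%:R ^+ 2)^-1 * fine (mu setT))%:C : R[i])).
  apply: eq_bigr => a _; rewrite (big_pred1 a)//= /fejer_avg_coef /freq/= subrr.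
  by rewrite mul0r cexp0 mulr1 fourier_coef0 rmorphM.
rewrite sumr_const card_ord -rmorphMn/=; congr (real_complex R _).
by rewrite -mulr_natl; field.
Qed.

Lemma sum_fejer_avg_powR (K N : nat) (t : R) :
  (0 < K <= q ^ N)%N -> 0 < t -> t <= 1 ->
  \sum_(i < q ^ N) fejer_avg K (i%:R / (q ^ N)%:R) `^ t^-1 <=
  (q ^ N)%:R * (expR (kappa B t / t) ^+ N * (K%:R^-1 * fine (mu setT)) `^ t^-1).
Proof.
move=> KN t0 t1.
have M0 : 0 < (q ^ N)%:R :> R by rewrite ltr0n expn_gt0 q_gt0.
have : tower_avg q N (fun x => fejer_avg K x `^ t^-1) 0 <=
    expR (kappa B t / t) ^+ N * (K%:R^-1 * fine (mu setT)) `^ t^-1.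
  rewrite -(tower_avg_fejer_avg 0 KN).
  exact: (tower_avg_powR q_gt0 B_gt0 (@fejer_avg_coef_spec K) (@fejer_avg_trig K) N 0
    (@fejer_avg_ge0 K) t0 t1).
rewrite (tower_avgE q_gt0) (ler_pdivrMl _ _ M0).
move=> h; apply: le_trans h.
by apply: ler_sum => i _; rewrite add0r.
Qed.

End FejerAvg.

(** * Estimates for series, large values and the choice of scale *)

Section RealLemmas.
Context (R : realType).

Lemma powR_expn (q n : nat) (c : R) : (q ^ n)%:R `^ c = (q%:R `^ c) ^+ n.
Proof.
elim: n => [|n IHn]; first by rewrite expn0 powR1.
by rewrite expnS natrM powRM// IHn exprS.
Qed.

Lemma exists_expr_le (z e : R) : 0 <= z -> z < 1 -> 0 < e -> exists n, z ^+ n <= e.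
Proof.
move=> z0 z1 e0; have /cvg_expr zc : `|z| < 1 by rewrite ger0_norm.
have [n _ /(_ n (leqnn n))/= ?] : \forall n \near \oo, z ^+ n <= e.
  exact: (cvgr_le 0).
by exists n.
Qed.

Lemma nneseries_le (u : nat -> R) (c : R) : (forall i, 0 <= u i) ->
  (forall n, \sum_(i < n) u i <= c) -> (\sum_(0 <= i <oo) (u i)%:E <= c%:E)%E.
Proof.
move=> u0 uc; apply: lime_le.
  by apply: is_cvg_nneseries => n _ _; rewrite lee_fin.
by apply: nearW => n; rewrite sumEFin lee_fin big_mkord.
Qed.

Lemma sum_geometric_le (a z : R) (n : nat) : 0 <= a -> 0 <= z -> z < 1 ->
  \sum_(i < n) a * z ^+ i <= a / (1 - z).
Proof.
move=> a0 z0 z1; rewrite -mulr_sumr ler_wpM2l//.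
rewrite -[leRHS]mul1r ler_pdivlMr ?subr_gt0// mulrC.
by rewrite -opprB mulNr -subrX1 opprB lerBlDr lerDl exprn_ge0.
Qed.

(** Where [a i * c >= 1], the factor [(a i * c) ^ r] is at least 1, so inserting it does not
    decrease the term. *)
Lemma sum_large_le (n : nat) (a : nat -> R) (c r : R) : 0 <= c -> 0 <= r ->
  (forall i, 0 <= a i) ->
  \sum_(i < n) (if 1 <= a i * c then a i else 0) <=
  c `^ r * \sum_(i < n) a i `^ (1 + r).
Proof.
move=> c0 r0 a0; rewrite mulr_sumr ler_sum// => i _.
case: ifPn => [ac|_]; last by rewrite mulr_ge0 ?powR_ge0.
have ai : 0 < a i.
  by rewrite lt0r a0 andbT; apply: contraTneq ac => ->; rewrite mul0r -ltNge.
rewrite powRD; last by apply/implyP => _; rewrite gt_eqF.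
rewrite powRr1// mulrCA ler_peMr// -powRM// mulrC.
apply: (@le_trans _ _ (1 `^ r)); first by rewrite powR1.
by apply: ge0_ler_powR => //; rewrite nnegrE// mulr_ge0.
Qed.

(** For [D > 0] take the finest admissible [N]: failure at the next scale gives
    [1 <= 8 * q * D * q ^ N.+2], to be raised to the power [b]. The term [e] is there for
    [D = 0]. *)
Lemma exists_scale (q N0 : nat) (b s D e : R) : (2 < q)%N -> 0 < b -> s <= b ->
  0 <= D -> D < (8 * (q ^ N0.+2)%:R)^-1 -> 0 < e ->
  exists N, [/\ (N0 <= N)%N, D < (8 * (q ^ N.+2)%:R)^-1 &
    4 * (q ^ N.+2)%:R `^ (- b) <= 4 * (8 * q%:R) `^ b * D `^ s + e].
Proof.
move=> q2 b0 sb D0 DN e0.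
have q0 : 0 < q%:R :> R by rewrite ltr0n (ltn_trans _ q2).
have q1 : 1 < q%:R :> R by rewrite ltr1n (ltn_trans _ q2).
have qn n : 0 < (q ^ n)%:R :> R by rewrite natrX exprn_gt0.
have [D00|D_neq0] := eqVneq D 0.
  have z1 : q%:R `^ (- b) < 1 :> R.
    by rewrite /powR gt_eqF// expR_lt1 mulNr oppr_lt0 mulr_gt0// ln_gt0.
  have [n zn] := exists_expr_le (powR_ge0 _ _) z1 (divr_gt0 e0 (ltr0n R 4)).
  exists (maxn N0 n); split; first exact: leq_maxl.
    by rewrite D00 invr_gt0 mulr_gt0.
  apply: (@le_trans _ _ e); last by rewrite lerDr !mulr_ge0 ?powR_ge0.
  rewrite mulrC -ler_pdivlMr// powR_expn; apply: le_trans zn.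
  rewrite ler_wiXn2l ?powR_ge0 ?(ltW z1)//.
  by rewrite (leq_trans (leq_maxr N0 n))// ltnW.
have {D_neq0}Dgt0 : 0 < D by rewrite lt0r D_neq0.
have exP : exists n, ~~ (D < (8 * (q ^ (N0 + n).+2)%:R)^-1).
  have qV1 : q%:R^-1 < 1 :> R by rewrite invf_lt1.
  have [n zn] := exists_expr_le (ltW (eqbRL (invr_gt0 _) q0)) qV1
    (mulr_gt0 (ltr0n R 8) Dgt0).
  exists n; rewrite -leNgt invfM ler_pdivrMl//; apply: le_trans zn.
  rewrite natrX -exprVn ler_wiXn2l ?invr_ge0 ?(ltW q0) ?(ltW qV1)//.
  by rewrite -addn2 -addnA addnCA leq_addr.
case: (ex_minnP exP) => -[|n]; first by rewrite addn0 DN.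
rewrite -leNgt => Dn /(_ n); rewrite ltnn => minn.
exists (N0 + n)%N; split; first exact: leq_addr.
  by rewrite ltNge; apply/negP => h; have := minn; rewrite -leNgt h => /(_ isT).
rewrite -mulrA; apply: ler_wpDr (ltW e0) _; rewrite ler_wpM2l//.
apply: (@le_trans _ _ ((8 * q%:R) `^ b * D `^ b)).
  rewrite -powRM ?mulr_ge0 ?(ltW q0)// powRN.
  rewrite -[leLHS]mul1r ler_pdivrMr ?powR_gt0// -powRM ?mulr_ge0 ?(ltW q0)//.
  apply: (@le_trans _ _ (1 `^ b)); first by rewrite powR1.
  apply: ge0_ler_powR; rewrite ?nnegrE ?(ltW b0)//.
    by rewrite !mulr_ge0// ltW.
  move: Dn; rewrite addnS -[leLHS]mul1r ler_pdivrMr ?mulr_gt0// expnS natrM.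
  by congr (1 <= _); ring.
(* Since [D <= 1], lowering the exponent from [b] to [s] does not decrease the power. *)
rewrite ler_wpM2l ?powR_ge0// /powR gt_eqF// ler_expR ler_wnM2r//.
apply: ln_le0; apply: le_trans (ltW DN) _.
by rewrite invf_le1 ?mulr_gt0// mulr_ege1 ?ler1n// expn_gt0 (ltn_trans _ q2).
Qed.

End RealLemmas.

(** * Cells, heavy cells and null sets *)

Section Cells.
Context (R : realType) (mu : {finite_measure set (borel_circle R) -> \bar R}).
Context (q : nat) (B : {set 'I_q}).
Hypotheses (q_gt2 : (2 < q)%N) (B_gt0 : forall b : 'I_q, b \in B -> (0 < b)%N).
Hypothesis spec : M_spec (C_set B) mu.

Let q_gt0 : (0 < q)%N. Proof. by rewrite (ltn_trans _ q_gt2). Qed.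

(* There are [q^(N+2)] cells, while the Fejer kernel only has degree [q^N]: as
   [3 <= q], it is then bounded below on a neighbourhood of each cell. *)
Definition mass (N J : nat) : R := fejer_avg mu (q ^ N) (J%:R / (q ^ N.+2)%:R).

(** A superlevel set of the kernel rather than an arc: continuity makes it measurable, and Markov's
    inequality bounds its measure by the kernel's integral. *)
Definition cell (N J : nat) : set (borel_circle R) :=
  [set x | 4^-1 <= circle_fun (fun y => fejer (q ^ N) (y - J%:R / (q ^ N.+2)%:R)) x].

Lemma measurable_cell (N J : nat) : measurable (cell N J).
Proof.
by apply: measurable_circle_fun_ge; [exact: fejer_continuous|exact: fejer_periodic].
Qed.

Lemma cell_measure (N J : nat) : (mu (cell N J) <= (4 * mass N J)%:E)%E.
Proof.
rewrite -{1}(invrK 4); apply: Rintegral_circle_fun_markov.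
- exact: fejer_continuous.
- exact: fejer_periodic.
- by move=> x; exact: fejer_bounded.
- by move=> x; exact: fejer_ge0.
- by [].
Qed.

(** With [M = q ^ N.+2], [J / M] is the grid point at or left of a representative of [x]. Points of
    [U] lie within [1 / (8 M) + 1 / M = 9 / (8 M)] of it, and [q >= 3] gives [q ^ N <= M / 9], so
    [fejer_ge] applies. *)
Lemma cell_cover (N : nat) (x : circle R) : exists J : 'I_(q ^ N.+2),
  forall U : set (circle R), U x ->
    diam U < (8 * (q ^ N.+2)%:R)^-1 -> U `<=` cell N J.
Proof.
set M := (q ^ N.+2)%:R; have M0 : 0 < M :> R by rewrite ltr0n expn_gt0 q_gt0.
have [a xa a01] := circle_rep01 x.
case/andP: a01 => a0 a1.
have aM0 : 0 <= a * M by rewrite mulr_ge0// ltW.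
have /andP[Jl Jr] := truncn_itv aM0.
set J := Num.truncn (a * M) in Jl Jr.
have JM : (J < q ^ N.+2)%N.
  rewrite -(ltr_nat R); apply: le_lt_trans Jl _.
  by rewrite -/M gtr_pMl.
exists (Ordinal JM) => U Ux Ud y Uy /=.
have [a' [b' [a'x b'y ab]]] := diam_close Ux Uy Ud.
(* Shifting [a'] and [b'] by the same integer [k] keeps their distance and brings [a'] to [a]. *)
have /circle_eqP[k a'E] : \pi_(circle R) a' = \pi_(circle R) a.
  by rewrite a'x xa.
have b'k : \pi_(circle R) (b' - k%:~R) = y.
  by rewrite -b'y; apply/circle_eqP; exists (- k); rewrite intrN.
rewrite /cell/= (circle_funE (@fejer_periodic R _ _) b'k).
apply: fejer_ge; first by rewrite expn_gt0 q_gt0.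
have d1 : `|a - J%:R / M| <= M^-1.
  rewrite -[X in X - _](mulfK (lt0r_neq0 M0)) -mulrBl normrM.
  rewrite (ger0_norm (ltW (eqbRL (invr_gt0 _) M0))) ler_piMl ?invr_ge0 ?(ltW M0)//.
  by rewrite ler_norml; move: Jr; rewrite -natr1 => Jr; apply/andP; split; lra.
have d2 : `|b' - k%:~R - J%:R / M| <= (8 * M)^-1 + M^-1.
  rewrite (_ : _ - _ = (b' - a') + (a - J%:R / M)); last by rewrite a'E; ring.
  apply: le_trans (ler_normD _ _) _; rewrite lerD// distrC; exact: ltW.
have KM : (q ^ N)%:R * M^-1 <= 9^-1 :> R.
  rewrite /M !expnSr !natrM -mulrA invfM mulrA divff ?mul1r; last first.
    by rewrite pnatr_eq0 -lt0n expn_gt0 q_gt0.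
  rewrite lef_pV2 ?posrE ?mulr_gt0 ?ltr0n//.
  by rewrite -natrM ler_nat (@leq_mul 3 3).
apply: (@le_trans _ _ ((q ^ N)%:R * ((8 * M)^-1 + M^-1))).
  by rewrite ler_wpM2l.
have -> : (q ^ N)%:R * ((8 * M)^-1 + M^-1) = (q ^ N)%:R * M^-1 * (9 / 8).
  by field; exact: lt0r_neq0.
apply: (@le_trans _ _ (9^-1 * (9 / 8))); last lra.
by rewrite ler_wpM2r//; lra.
Qed.

Definition heavy (b : R) (N : nat) : set (borel_circle R) :=
  \big[setU/set0]_(J < q ^ N.+2)
    (if 1 <= mass N J * (q ^ N.+2)%:R `^ b then cell N J else set0).

Lemma measurable_heavy (b : R) (N : nat) : measurable (heavy b N).
Proof.
apply: bigsetU_measurable => J _; case: ifP => _ //; exact: measurable_cell.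
Qed.

(** With [M = q ^ N.+2], use [sum_large_le] for [c = M ^ b] and [1 + r = 1 / t], then the power sum
    estimate over [N + 2] levels. *)
Lemma heavy_measure (b t : R) (N : nat) : 0 < t -> t < 1 ->
  (mu (heavy b N) <=
   (4 * ((q ^ 2)%:R * fine (mu setT)) `^ t^-1 *
    expR ((b - 1) * ln q%:R * (t^-1 - 1) + kappa B t / t) ^+ N.+2)%:E)%E.
Proof.
move=> t0 t1.
set r := t^-1 - 1.
have r0 : 0 < r by rewrite subr_gt0 invf_gt1.
have M0 : 0 < (q ^ N.+2)%:R :> R by rewrite ltr0n expn_gt0 q_gt0.
have mass0 J : 0 <= mass N J by exact: fejer_avg_ge0.
pose heavyJ J := 1 <= mass N J * (q ^ N.+2)%:R `^ b.
pose bad J := if heavyJ J then cell N J else set0.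
pose f J := if heavyJ J then mass N J else 0.
have h1 : (mu (heavy b N) <= (4 * \sum_(J < q ^ N.+2) f J)%:E)%E.
  apply: (@le_trans _ _ (\sum_(J < q ^ N.+2) mu (bad J))%E).
    apply: (Boole_inequality mu (A := bad)) => J _.
    by rewrite /bad; case: ifP => _ //; exact: measurable_cell.
  rewrite mulr_sumr -sumEFin; apply: lee_sum => J _.
  by rewrite /bad /f; case: ifP => _; [exact: cell_measure|rewrite measure0 mulr0].
apply: le_trans h1 _; rewrite lee_fin -mulrA ler_wpM2l//.
apply: le_trans (sum_large_le _ (powR_ge0 _ _) (ltW r0) mass0) _.
have KN : (0 < q ^ N <= q ^ N.+2)%N.
  by rewrite expn_gt0 q_gt0/= leq_exp2l ?(ltn_trans _ q_gt2)// leqW.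
have pE : 1 + r = t^-1 by rewrite /r; ring.
have m0 : 0 <= (q ^ 2)%:R * fine (mu setT) :> R.
  by rewrite mulr_ge0// fine_ge0.
have qR0 : 0 < q%:R :> R by rewrite ltr0n.
rewrite pE; apply: le_trans (ler_wpM2l (powR_ge0 _ _)
  (sum_fejer_avg_powR q_gt0 B_gt0 spec KN t0 (ltW t1))) _.
(* The kernel has parameter [q ^ N] while there are [q ^ N.+2] cells; the surplus [q ^ 2] goes into
   the constant. *)
have -> : (q ^ N)%:R^-1 * fine (mu setT) =
    (q ^ 2)%:R * fine (mu setT) / (q ^ N.+2)%:R.
  rewrite -(addn2 N) expnD natrM; field.
  by rewrite !pnatr_eq0 -!lt0n !expn_gt0 q_gt0.
have -> : ((q ^ 2)%:R * fine (mu setT) / (q ^ N.+2)%:R) `^ t^-1 =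
    ((q ^ 2)%:R * fine (mu setT)) `^ t^-1 * (q ^ N.+2)%:R `^ (- t^-1).
  rewrite powRM// ?invr_ge0 ?(ltW M0)//; congr (_ * _).
  by rewrite -(powR_inv1 (ltW M0)) -powRrM mulN1r.
have -> : expR ((b - 1) * ln q%:R * r + kappa B t / t) ^+ N.+2 =
    (q ^ N.+2)%:R `^ ((b - 1) * r) * expR (kappa B t / t) ^+ N.+2.
  rewrite powR_expn -exprMn; congr (_ ^+ _).
  by rewrite expRD /powR gt_eqF//; congr (expR _ * _); ring.
(* The exponents agree because [(b - 1) * r = b * r + 1 - 1 / t]. *)
have -> : (q ^ N.+2)%:R `^ ((b - 1) * r) =
    (q ^ N.+2)%:R `^ b `^ r * (q ^ N.+2)%:R * (q ^ N.+2)%:R `^ (- t^-1).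
  rewrite -powRrM -{3}(powRr1 (ltW M0)) -!powRD.
  2,3: by apply/implyP => _; rewrite gt_eqF.
  by congr (_ `^ _); rewrite -pE; ring.
rewrite le_eqVlt; apply/orP; left; apply/eqP; ring.
Qed.

Section Null.
Context (b s t : R) (F : set (borel_circle R)).
Hypotheses (b_gt0 : 0 < b) (s_le_b : s <= b) (t_gt0 : 0 < t) (t_lt1 : t < 1).
Hypothesis kappa_lt : kappa B t < (t - 1) * ((b - 1) * ln q%:R).
Hypotheses (mF : measurable F) (F0 : hausdorff_measure s F = 0%E).

(** The ratio of the geometric bound in [heavy_measure]; [kappa_lt] says that its logarithm is
    negative. *)
Let rho := expR ((b - 1) * ln q%:R * (t^-1 - 1) + kappa B t / t).

Let rho_lt1 : rho < 1.
Proof.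
rewrite expR_lt1.
rewrite (_ : _ + _ = (kappa B t - (t - 1) * ((b - 1) * ln q%:R)) / t).
  by rewrite pmulr_llt0 ?invr_gt0// subr_lt0.
by field; exact: lt0r_neq0.
Qed.

Let heavy_tail (e : R) : 0 < e -> exists N0,
  (mu (\bigcup_i heavy b (N0 + i)) <= e%:E)%E.
Proof.
move=> e0; set C := 4 * ((q ^ 2)%:R * fine (mu setT)) `^ t^-1.
have C0 : 0 <= C by rewrite mulr_ge0// powR_ge0.
have rho0 : 0 <= rho by exact: expR_ge0.
(* [C + 1] replaces [C] in the denominator because [C] is 0 when [mu] is. *)
have e'0 : 0 < e * (1 - rho) / (C + 1).
  by rewrite divr_gt0 ?mulr_gt0 ?subr_gt0// ltr_wpDl.
have [N0 N0P] := exists_expr_le rho0 rho_lt1 e'0; exists N0.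
apply: (@le_trans _ _ (\sum_(0 <= i <oo) mu (heavy b (N0 + i)))%E).
  apply: measure_sigma_subadditive => // [i|]; first exact: measurable_heavy.
  by apply: bigcupT_measurable => i; exact: measurable_heavy.
apply: (@le_trans _ _ (\sum_(0 <= i <oo) (C * rho ^+ N0 * rho ^+ i)%:E)%E).
  apply: lee_nneseries => // i _; apply: le_trans (heavy_measure _ _ t_gt0 t_lt1) _.
  rewrite lee_fin -/C -/rho -mulrA -exprD ler_wpM2l// ler_wiXn2l ?(ltW rho_lt1)//.
  by rewrite ltnW// ltnW.
apply: nneseries_le => [i|n].
  exact: mulr_ge0 (mulr_ge0 C0 (exprn_ge0 _ rho0)) (exprn_ge0 _ rho0).
have CN0 := mulr_ge0 C0 (exprn_ge0 N0 rho0).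
apply: le_trans (sum_geometric_le n CN0 rho0 rho_lt1) _.
rewrite ler_pdivrMr ?subr_gt0//; apply: le_trans (ler_wpM2l C0 N0P) _.
rewrite mulrA ler_pdivrMr ?ltr_wpDl//.
rewrite mulrC ler_wpM2l//; last by rewrite lerDl.
by rewrite mulr_ge0 ?subr_ge0 ?(ltW e0) ?(ltW rho_lt1).
Qed.

(** Sets of a Hausdorff cover are arbitrary, hence the measurable [A]. If [x] in [U] avoids the
    heavy cells from level [N0] on, the cell found around [x] at the scale of [exists_scale]
    contains [U]; containing [x], it is not heavy. *)
Let light_cover (N0 : nat) (e : R) (U : set (circle R)) : 0 < e ->
  diam U < (8 * (q ^ N0.+2)%:R)^-1 ->
  exists A : set (borel_circle R), [/\ measurable A,
    U `&` ~` (\bigcup_i heavy b (N0 + i)) `<=` A &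
    (mu A <= (4 * (8 * q%:R) `^ b * gauge s U + e)%:E)%E].
Proof.
move=> e0 Ud.
have gauge0 : 0 <= gauge s U by rewrite /gauge; case: ifP => _ //; exact: powR_ge0.
have [->|/set0P[x [Ux xH]]] := eqVneq (U `&` ~` (\bigcup_i heavy b (N0 + i))) set0.
  exists set0; split=> //.
  by rewrite measure0 lee_fin addr_ge0 ?(ltW e0)// !mulr_ge0 ?powR_ge0.
have gE : gauge s U = diam U `^ s.
  by rewrite /gauge ifF//; apply/negbTE/set0P; exists x.
have [N [N0N UN Ne]] := exists_scale q_gt2 b_gt0 s_le_b (diam_ge0 U) Ud e0.
have [J JP] := cell_cover N x.
exists (cell N J); split; first exact: measurable_cell.
  by move=> y [Uy _]; exact: (JP U).
rewrite gE; apply: le_trans (cell_measure N J) _; rewrite lee_fin.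
apply: le_trans Ne; rewrite ler_wpM2l//.
have M0 : 0 < (q ^ N.+2)%:R :> R by rewrite ltr0n expn_gt0 q_gt0.
rewrite powRN -[leRHS]mul1r ler_pdivlMr ?powR_gt0// leNgt; apply/negP => /ltW h.
apply: xH; exists (N - N0)%N => //; rewrite subnKC// /heavy.
rewrite -(bigcup_mkord _ (fun J =>
  if 1 <= mass N J * (q ^ N.+2)%:R `^ b then cell N J else set0)).
by exists J; rewrite /= ?ltn_ord// h; exact: (JP _ Ux UN _ Ux).
Qed.

(** [e] is split into thirds: the heavy cells from level [N0] on, [C] times the gauge sum, and the
    errors of [light_cover]. *)
Lemma hausdorff_null : mu F = 0%E.
Proof.
apply/eqP; rewrite eq_le measure_ge0 andbT.
apply/lee_addgt0Pr => e e0; rewrite add0e.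
have e3 : 0 < e / 3 by rewrite divr_gt0.
have [N0 HN0] := heavy_tail e3.
set H := \bigcup_i _ in HN0.
set C := 4 * (8 * q%:R) `^ b : R.
have C0 : 0 <= C by rewrite mulr_ge0// powR_ge0.
have M0 : 0 < (q ^ N0.+2)%:R :> R by rewrite ltr0n expn_gt0 q_gt0.
(* Covers satisfy [diam <= d] while [light_cover] wants a strict bound, so 9 replaces 8. *)
pose d : R := (9 * (q ^ N0.+2)%:R)^-1.
have d0 : 0 < d by rewrite invr_gt0 mulr_gt0.
have d1 : d < (8 * (q ^ N0.+2)%:R)^-1.
  by rewrite ltf_pV2 ?posrE ?mulr_gt0// ltr_pM2r// ltr_nat.
pose eta := e / 3 / (C + 1).
have eta0 : 0 < eta by rewrite divr_gt0// ltr_wpDl.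
have : (hausdorff_content s d F < eta%:E)%E.
  apply: (@le_lt_trans _ _ 0%E); last by rewrite lte_fin.
  by rewrite -F0; apply: ereal_sup_ubound; exists d.
move=> /ereal_inf_lt[_ [U [FU Ud] <-] Ueta].
have gauge0 i : 0 <= gauge s (U i).
  by rewrite /gauge; case: ifP => _ //; exact: powR_ge0.
(* The errors [e / 3 / 2 ^ i.+1] add up to [e / 3]. *)
have [A AP] := choice (fun i => @light_cover N0 (e / 3 / (2 ^ i.+1)%:R) (U i)
  (divr_gt0 e3 (eqbRL (ltr0n R _) (expn_gt0 2 i.+1))) (le_lt_trans (Ud i) d1)).
have mA i : measurable (A i) by case: (AP i).
have mH : measurable H by apply: bigcupT_measurable => i; exact: measurable_heavy.
have mAU : measurable (\bigcup_i A i) by exact: bigcupT_measurable.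
apply: (@le_trans _ _ (mu (H `|` \bigcup_i A i))).
  apply: le_measure; rewrite ?inE//; first exact: measurableU.
  move=> x Fx; have [Hx|nHx] := pselect (H x); first by left.
  have [i _ Uix] := FU _ Fx; right; exists i => //.
  by case: (AP i) => _ + _; apply.
apply: le_trans (measureU2 mu mH mAU) _.
have -> : e%:E = ((e / 3)%:E + (e / 3 + e / 3)%:E)%E.
  by rewrite -EFinD; congr EFin; field.
apply: leeD => //.
apply: (@le_trans _ _ (\sum_(0 <= i <oo) mu (A i))%E).
  exact: measure_sigma_subadditive.
apply: (@le_trans _ _ (\sum_(0 <= i <oo)
   ((C%:E * (gauge s (U i))%:E) + (e / 3 / (2 ^ i.+1)%:R)%:E))%E).
  by apply: lee_nneseries => // i _; case: (AP i).
apply: le_trans (epsilon_trick xpredT _ (ltW e3)) _.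
  by move=> i; rewrite mule_ge0 ?lee_fin.
rewrite EFinD leeD// nneseriesZl; last by move=> i _; rewrite lee_fin.
apply: le_trans (lee_wpmul2l _ (ltW Ueta)) _; rewrite ?lee_fin//.
by rewrite /eta mulrA ler_pdivrMr ?ltr_wpDl// mulrC ler_wpM2l ?(ltW e3)// lerDl.
Qed.
End Null.
End Cells.

(** * The dimension bound *)

Theorem theorem2p8 (R : realType) (q : nat) (hq : (2 < q)%N)
    (B : {set 'I_q}) (hB : forall b : 'I_q, b \in B -> (0 < b)%N)
    (mu : {finite_measure set (borel_circle R) -> \bar R})
    (hmu : M_spec (C_set B) mu) :
  ((1 + left_derivative (@kappa R q B) 1 / ln (q%:R : R))%:E
     <= lower_hausdorff_dim mu)%E.
Proof.
have q0 : (0 < q)%N by rewrite (ltn_trans _ hq).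
have lnq : 0 < ln q%:R :> R by rewrite ln_gt0// ltr1n (ltn_trans _ hq).
apply: le_ereal_inf_tmp => _ [a [F [mF muF Fa]] <-].
rewrite lee_fin leNgt; apply/negP.
set D := left_derivative _ _ => aD.
(* The midpoint leaves room on both sides: above [a] for an exponent [s] with zero Hausdorff
   measure, below the claimed bound for a difference quotient of [kappa]. *)
pose b := (a + (1 + D / ln q%:R)) / 2.
have ab : a < b by rewrite /b; lra.
have bD : (b - 1) * ln q%:R < D.
  by rewrite -ltr_pdivlMr// /b; lra.
(* [hausdorff_dim] is an infimum over nonnegative exponents; this makes [b] positive. *)
have a0 : 0 <= a.
  rewrite -lee_fin; apply: le_trans Fa.
  by apply: le_ereal_inf_tmp => _ [s [s0 _] <-]; rewrite lee_fin.
have b0 : 0 < b := le_lt_trans a0 ab.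
(* [t = 1 + h] lies in [(0, 1)] and satisfies the hypothesis [kappa_lt]. *)
have [h /andP[h1 h0] kh] := kappa_left_quotient q0 bD.
have : (hausdorff_dim F < b%:E)%E by apply: le_lt_trans Fa _; rewrite lte_fin.
move=> /ereal_inf_lt[_ [s [s0 Fs] <-]]; rewrite lte_fin => sb.
apply: muF.
apply: (@hausdorff_null _ _ _ _ hq hB hmu b s (1 + h)) => //; [exact: ltW|lra|lra|].
by rewrite addrAC subrr add0r.
Qed.
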